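(* For all integers $q \ge d \ge c \ge 1$, $B(q,d,c) \le p(q,d,c)$, where $p(q,d,c)$ is the smallest prime number that is at least $\left\lceil \frac{q-c+1}{d-c+1}\right\rceil$. That is, every $f:\binom{[q]}{d}\to[c]$ has a $p(q,d,c)$-cover.
   Context: $\binom{[q]}{d}$ denotes the family of $d$-element subsets of $[q]=\{1,\dots,q\}$. A function $f:\binom{[q]}{d}\to[c]$ has a $t$-cover if there exist $S_1,\dots,S_t\in\binom{[q]}{d}$ (not necessarily distinct) with $S_1\cup\dots\cup S_t=[q]$ and $f(S_1)=\dots=f(S_t)$. $B(q,d,c)$ is the minimum $t$ such that every $f:\binom{[q]}{d}\to[c]$ has a $t$-cover. *)

(* Defs.v *)
From mathcomp Require Import all_boot.
Set Implicit Arguments. Unset Strict Implicit. Unset Printing Implicit Defensive.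

Definition dsubset (q d : nat) := {S : {set 'I_q} | #|S| == d}.

Definition has_cover (q d c t : nat) (f : dsubset q d -> 'I_c) : Prop :=
  exists (S : 'I_t -> dsubset q d),
    \bigcup_(i < t) val (S i) = [set: 'I_q] /\
    exists col : 'I_c, forall i : 'I_t, f (S i) = col.

Arguments has_cover : clear implicits.

Definition ceil_div (a b : nat) : nat := (a + b - 1) %/ b.

Definition is_least_prime_geq (p n : nat) : Prop :=
  prime p /\ n <= p /\ forall r, prime r -> n <= r -> p <= r.

(* Main.v *)
Require Import Defs.
From mathcomp Require Import all_boot all_algebra fingroup cyclic zify.
From HB Require Import structures.
Set Implicit Arguments. Unset Strict Implicit. Unset Printing Implicit Defensive.
Import GRing.Theory.
Local Open Scope ring_scope.

(* Over an abelian group [G] of prime order [p], label [p - 1] copies of each point by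
   elements of [G] or nothing. Such a signed vector [X] gives sets [parts X t] (the points
   having a copy labelled [t]) with empty intersection. If some part contains the
   complement of a [d]-set, record for each [t] the colours of the [d]-sets with complement
   inside [parts X t]; if no monochromatic family covers, no colour occurs for all [t].
   Otherwise record the parts themselves, which then have fewer than [q - d] elements.
   Either record grows with [X] and is moved by the rotations of [G], so its total size,
   shifted in the first case, is a level, and an equivariant choice of orbit
   representatives gives a label in [G], constant along comparable signed vectors of equal
   level. By a Tucker lemma for [G] the number [q (p - 1)] of coordinates is at most the
   maximal level [p (q - d - 1) + c (p - 1)], which contradicts the choice of [p].

   The Tucker lemma is a Lefschetz argument. Signed vectors are the faces of a join of
   copies of [G], and a labelling induces an equivariant endomorphism of its augmented chain
   complex. If some coordinate is not a level, joining with a vertex in that coordinate is a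
   null-homotopy of this endomorphism, whose supertrace therefore vanishes. But [G] permutes
   the nonempty faces freely, so modulo the order of [G] only the empty face counts, and the
   supertrace is [1]. *)

(** * Chains *)

Lemma sum_antisymmetric (V : zmodType) (I : finType) (A : {set I}) (t : I -> I -> V) :
    {in A &, forall i k, i != k -> t i k = - t k i} ->
  \sum_(i in A) \sum_(k in A | k != i) t i k = 0.
Proof.
move=> tC; pose lt (i k : I) := (enum_rank i < enum_rank k)%N.
have gtE i k : (k != i) && ~~ lt i k = lt k i.
  by rewrite -leqNgt [RHS]ltn_neqAle (inj_eq val_inj) (inj_eq enum_rank_inj).
have neq_lt i k : lt i k -> i != k by rewrite -gtE => /andP[].
under eq_bigr => i _ do rewrite (bigID (lt i)) /=.
rewrite big_split /= (exchange_big_dep (mem A)) => [|i k _ /andP[/andP[]]] //=.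
rewrite -big_split big1 //= => i iA; apply/eqP; rewrite addr_eq0 -sumrN; apply/eqP.
apply: eq_big => [k|k /andP[kA /andP[_ /neq_lt ki]]]; last exact: tC.
rewrite iA -[in RHS]andbA gtE; congr (_ && _).
by rewrite andb_idl // eq_sym => /neq_lt.
Qed.

Section Chains.
Variables (R : comNzRingType) (T : finType).
Local Notation chain := {ffun T -> R^o}.
Implicit Types (c : chain) (F : T -> chain).

Definition cbasis (x : T) : chain := [ffun y => (x == y)%:R].

Definition linext F c : chain := \sum_x c x *: F x.

Lemma linext_is_linear F : linear (linext F).
Proof.
move=> a c c'; rewrite /linext scaler_sumr -big_split; apply: eq_bigr => x _ /=.
by rewrite !ffunE scalerDl scalerA.
Qed.

HB.instance Definition _ F :=
  GRing.isLinear.Build R chain chain *:%R (linext F) (linext_is_linear F).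

Lemma linextE F c y : linext F c y = \sum_x c x * F x y.
Proof. by rewrite sum_ffunE; apply: eq_bigr => x _; rewrite ffunE. Qed.

Lemma linext_basis F x : linext F (cbasis x) = F x.
Proof.
rewrite /linext (bigD1 x) //= ffunE eqxx scale1r big1 ?addr0 // => y yx.
by rewrite ffunE eq_sym (negPf yx) scale0r.
Qed.

Lemma linext_id c : linext cbasis c = c.
Proof.
apply/ffunP => y; rewrite linextE (bigD1 y) //= ffunE eqxx mulr1 big1 ?addr0 // => x xy.
by rewrite ffunE (negPf xy) mulr0.
Qed.

Lemma linext_comp F E c : linext F (linext E c) = linext (fun x => linext F (E x)) c.
Proof. by rewrite {2}/linext linear_sum; apply: eq_bigr => x _; rewrite linearZ. Qed.

Lemma eq_linext F E c : (forall x, c x != 0 -> F x = E x) -> linext F c = linext E c.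
Proof.
move=> FE; apply: eq_bigr => x _.
by have [->|/FE->] := eqVneq (c x) 0; rewrite ?scale0r.
Qed.

Lemma linext_neq0 F c y : linext F c y != 0 -> exists2 x, c x != 0 & F x y != 0.
Proof.
move=> nz; have /existsP[x] : [exists x, c x * F x y != 0].
  apply: contraNT nz => /existsPn all0; rewrite linextE big1 // => x _.
  exact/eqP/negPn/all0.
move=> cF; exists x; first by apply: contraNneq cF => ->; rewrite mul0r.
by apply: contraNneq cF => ->; rewrite mulr0.
Qed.

Lemma supertrace_homotopy (e : T -> R) (d g : T -> chain) :
    (forall x y, d x y != 0 -> e y = - e x) ->
  \sum_x e x * (linext d (g x) + linext g (d x)) x = 0.
Proof.
move=> d_odd; under eq_bigr do rewrite ffunE mulrDr !linextE !mulr_sumr.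
rewrite big_split /= [X in _ + X]exchange_big -big_split big1 //= => x _.
rewrite -big_split big1 //= => y _.
have [->|/d_odd->] := eqVneq (d y x) 0; first by rewrite mulr0 mul0r !mulr0 addr0.
by rewrite [g x y * _]mulrC mulNr addNr.
Qed.

End Chains.

(** * Signed vectors and the join complex *)

Section SignVectors.
Variables (I : finType) (G : finZmodType).

Definition signvec := {ffun I -> option G}.
Implicit Types (X Y Z : signvec) (i k : I) (a : G).

Definition sv0 : signvec := [ffun => None].
Definition svset i (o : option G) X : signvec := [ffun k => if k == i then o else X k].
Definition svsupp X : {set I} := [set i | X i != None].
Definition svshift a X : signvec := [ffun i => omap (+%R^~ a) (X i)].
Definition svle X Y := [forall i, (X i == None) || (X i == Y i)].

Lemma svset_same i X : svset i (X i) X = X.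
Proof. by apply/ffunP => k; rewrite ffunE; case: eqP => [->|]. Qed.

Lemma svset_overwrite i o o' X : svset i o (svset i o' X) = svset i o X.
Proof. by apply/ffunP => k; rewrite !ffunE; case: eqP. Qed.

Lemma svsetC i k o o' X : i != k -> svset i o (svset k o' X) = svset k o' (svset i o X).
Proof.
by move=> ik; apply/ffunP => j; rewrite !ffunE; case: (j =P i) => // ->; rewrite (negPf ik).
Qed.

Lemma svsupp_erase i X : svsupp (svset i None X) = svsupp X :\ i.
Proof. by apply/setP => k; rewrite !inE ffunE; case: (k == i). Qed.

Lemma card_svsupp_erase i X : i \in svsupp X -> #|svsupp X| = #|svsupp (svset i None X)|.+1.
Proof. by move=> iX; rewrite (cardsD1 i) iX svsupp_erase. Qed.

Lemma svsupp0 : svsupp sv0 = set0.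
Proof. by apply/setP => i; rewrite !inE ffunE. Qed.

Lemma svsupp_eq0 X : (svsupp X == set0) = (X == sv0).
Proof.
apply/eqP/eqP => [/setP X0|->]; last exact: svsupp0.
by apply/ffunP => i; have := X0 i; rewrite !inE ffunE => /negbFE/eqP.
Qed.

Lemma face_ind (P : signvec -> Prop) :
    P sv0 ->
    (forall X, X != sv0 -> (forall i, i \in svsupp X -> P (svset i None X)) -> P X) ->
  forall X, P X.
Proof.
move=> P0 PS X; have [n] := ubnP #|svsupp X|; elim: n X => // n IH X Xn.
have [->//|nX] := eqVneq X sv0; apply: PS => // i iX; apply: IH.
by rewrite -ltnS -card_svsupp_erase.
Qed.

Lemma svleP X Y : reflect (forall i, X i = None \/ X i = Y i) (svle X Y).
Proof.
apply: (iffP forallP) => XY i; first by case/orP: (XY i) => /eqP; [left|right].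
by case: (XY i) => ->; rewrite eqxx ?orbT.
Qed.

Lemma svle_refl X : svle X X.
Proof. by apply/svleP; right. Qed.

Lemma svle_trans X Y Z : svle X Y -> svle Y Z -> svle X Z.
Proof.
by move=> /svleP XY /svleP YZ; apply/svleP => i; case: (XY i) => ->; [left|].
Qed.

Lemma svle_neq0 X Y : X != sv0 -> svle X Y -> Y != sv0.
Proof.
move=> nX /svleP XY; apply: contraNneq nX => Y0; apply/eqP/ffunP => i.
by case: (XY i) => ->; rewrite ?Y0 ffunE.
Qed.

Lemma svle_erase i X : svle (svset i None X) X.
Proof. by apply/svleP => k; rewrite ffunE; case: eqP; [left|right]. Qed.

Lemma svshiftK a : cancel (svshift a) (svshift (- a)).
Proof. by move=> X; apply/ffunP => i; rewrite !ffunE; case: (X i) => //= b; rewrite addrK. Qed.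

Lemma svshift_inj a : injective (svshift a).
Proof. exact: can_inj (svshiftK a). Qed.

Lemma svshift_set a i o X : svshift a (svset i o X) = svset i (omap (+%R^~ a) o) (svshift a X).
Proof. by apply/ffunP => k; rewrite !ffunE; case: eqP. Qed.

Lemma svshift_eqNone a X i : (svshift a X i == None) = (X i == None).
Proof. by rewrite ffunE; case: (X i). Qed.

Lemma svsupp_shift a X : svsupp (svshift a X) = svsupp X.
Proof. by apply/setP => i; rewrite !inE svshift_eqNone. Qed.

Lemma svshift_sv0 a : svshift a sv0 = sv0.
Proof. by apply/ffunP => i; rewrite !ffunE. Qed.

Lemma svshift_eq0 a X : (svshift a X == sv0) = (X == sv0).
Proof. by rewrite -!svsupp_eq0 svsupp_shift. Qed.

End SignVectors.

Local Notation sverase i := (svset i None).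

Section JoinComplex.
Variables (R : comNzRingType) (I : finType) (G : finZmodType).
Local Notation signvec := (signvec I G).
Local Notation chain := {ffun signvec -> R^o}.
Implicit Types (X Y : signvec) (i k : I) (a b : G) (c : chain).

Definition svsign X i : R :=
  (-1) ^+ #|[set k in svsupp X | (enum_rank i < enum_rank k)%N]|.

Definition boundary X : chain := \sum_(i in svsupp X) svsign X i *: cbasis R (sverase i X).

Definition svjoin i a X : chain :=
  if X i == None then svsign X i *: cbasis R (svset i (Some a) X) else 0.

Lemma svsign_sqr X i : svsign X i * svsign X i = 1.
Proof. by rewrite -expr2 sqrr_sign. Qed.

Lemma svsign_erase X i k : i \in svsupp X ->
  svsign (sverase i X) k = (-1) ^+ (enum_rank k < enum_rank i)%N * svsign X k.
Proof.
move=> iX; rewrite /svsign [in RHS](cardsD1 i) inE iX exprD signrMK.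
by congr (_ ^+ #|pred_of_set _|); apply/setP => j; rewrite svsupp_erase !inE andbA.
Qed.

Lemma signr_rank_neq i k : i != k ->
  (-1) ^+ (enum_rank i < enum_rank k)%N * (-1) ^+ (enum_rank k < enum_rank i)%N = -1 :> R.
Proof.
by case: ltngtP => [||/val_inj/enum_rank_inj->]; rewrite ?mulr1 ?mul1r ?eqxx.
Qed.

Lemma svsign_eraseC X i k : i \in svsupp X -> k \in svsupp X -> i != k ->
  svsign X i * svsign (sverase i X) k = - (svsign X k * svsign (sverase k X) i).
Proof.
move=> iX kX ik; rewrite -[RHS]mulN1r -(signr_rank_neq ik) !svsign_erase // mulrCA.
by rewrite [svsign X k * _]mulrCA [_ ^+ _ * _ ^+ _]mulrC -mulrA signrMK [svsign X k * _]mulrC.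
Qed.

Lemma linext_boundary (F : signvec -> chain) X :
  linext F (boundary X) = \sum_(i in svsupp X) svsign X i *: F (sverase i X).
Proof. by rewrite linear_sum; apply: eq_bigr => i _; rewrite linearZ /= linext_basis. Qed.

Lemma boundary_neq0 X Y : boundary X Y != 0 -> exists2 i, i \in svsupp X & Y = sverase i X.
Proof.
move=> nz; have /existsP[i /andP[iX /eqP]] :
    [exists i, (i \in svsupp X) && (sverase i X == Y)].
  apply: contraNT nz => /existsPn nY; rewrite sum_ffunE big1 // => i iX.
  by have := nY i; rewrite iX !ffunE /= => /negPf->; apply: mulr0.
by exists i.
Qed.

Lemma boundary_sv0 : boundary (sv0 I G) = 0.
Proof. by rewrite /boundary svsupp0 big_set0. Qed.

Lemma boundary_boundary X : linext boundary (boundary X) = 0.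
Proof.
pose face i k : chain := (svsign X i * svsign (sverase i X) k) *:
  cbasis R (sverase k (sverase i X)).
have faceC : {in svsupp X &, forall i k, i != k -> face i k = - face k i}.
  by move=> i k iX kX ik; rewrite /face svsign_eraseC // scaleNr svsetC // eq_sym.
rewrite -[RHS](sum_antisymmetric faceC) linext_boundary; apply: eq_bigr => i iX.
rewrite scaler_sumr; apply: eq_big => [k|k _]; first by rewrite svsupp_erase !inE andbC.
by rewrite scalerA.
Qed.

Lemma boundary_join_none i a X : X i = None ->
  linext boundary (svjoin i a X) + linext (svjoin i a) (boundary X) = cbasis R X.
Proof.
move=> Xi; set Y := svset i (Some a) X.
have iY : i \in svsupp Y by rewrite inE ffunE eqxx.
have eraseY : sverase i Y = X by rewrite svset_overwrite -Xi svset_same.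
have signX k : svsign X k = (-1) ^+ (enum_rank k < enum_rank i)%N * svsign Y k.
  by rewrite -eraseY svsign_erase.
have signXi : svsign X i = svsign Y i by rewrite signX ltnn mul1r.
rewrite linext_boundary /svjoin Xi eqxx linearZ /= linext_basis.
rewrite /boundary (big_setD1 i) //= eraseY scalerDr scalerA -signXi svsign_sqr.
rewrite scale1r -addrA -[RHS]addr0; congr (_ + _).
rewrite -svsupp_erase eraseY scaler_sumr -big_split big1 //= => k kX.
have ik : i != k by apply: contraTneq kX => <-; rewrite inE Xi.
rewrite ffunE (negPf ik) Xi eqxx (svsetC _ _ _ ik) !scalerA -scalerDl.
rewrite (svsign_erase _ kX) mulrCA mulrA [svsign X k]signX mulrA signr_rank_neq //.
by rewrite mulN1r mulNr [svsign Y k * _]mulrC subrr scale0r.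
Qed.

Lemma boundary_join_some i a X : X i = Some a ->
  linext boundary (svjoin i a X) + linext (svjoin i a) (boundary X) = cbasis R X.
Proof.
move=> Xi; have iX : i \in svsupp X by rewrite inE Xi.
rewrite linext_boundary {1}/svjoin Xi linear0 add0r (big_setD1 i) //=.
rewrite big1 => [|k /setD1P[ki _]].
  rewrite addr0 /svjoin ffunE eqxx scalerA svsign_erase // ltnn mul1r svsign_sqr scale1r.
  by rewrite svset_overwrite -Xi svset_same.
by rewrite /svjoin ffunE [i == k]eq_sym (negPf ki) Xi scaler0.
Qed.

Lemma boundary_join i a c : (forall X, c X != 0 -> X i \in [:: None; Some a]) ->
  linext boundary (linext (svjoin i a) c) + linext (svjoin i a) (linext boundary c) = c.
Proof.
move=> ci; rewrite !linext_comp -[RHS](linext_id c) -big_split.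
apply: eq_bigr => X _ /=; rewrite -scalerDr.
have [->|/ci] := eqVneq (c X) 0; first by rewrite !scale0r.
by rewrite !inE => /orP[]/eqP Xi; rewrite ?(boundary_join_none _ Xi) ?(boundary_join_some Xi).
Qed.

Lemma linext_shift a (F F' : signvec -> chain) c c' :
    (forall X Y, F' (svshift a X) (svshift a Y) = F X Y) ->
    (forall X, c' (svshift a X) = c X) ->
  forall X, linext F' c' (svshift a X) = linext F c X.
Proof.
move=> FF' cc' X; rewrite !linextE (reindex_inj (@svshift_inj _ _ a)).
by apply: eq_bigr => Y _; rewrite cc' FF'.
Qed.

Lemma cbasis_shift a X Y : cbasis R (svshift a X) (svshift a Y) = cbasis R X Y.
Proof. by rewrite !ffunE (inj_eq (@svshift_inj _ _ a)). Qed.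

Lemma svsign_shift a X i : svsign (svshift a X) i = svsign X i.
Proof. by rewrite /svsign svsupp_shift. Qed.

Lemma boundary_shift a X Y : boundary (svshift a X) (svshift a Y) = boundary X Y.
Proof.
rewrite !sum_ffunE svsupp_shift; apply: eq_bigr => i _.
have -> : sverase i (svshift a X) = svshift a (sverase i X) by rewrite svshift_set.
by rewrite ffunE cbasis_shift svsign_shift [RHS]ffunE.
Qed.

Lemma svjoin_shift i a b X Y :
  svjoin i (b + a) (svshift a X) (svshift a Y) = svjoin i b X Y.
Proof.
rewrite /svjoin svshift_eqNone; case: ifP => _; last by rewrite !ffunE.
have -> : svset i (Some (b + a)) (svshift a X) = svshift a (svset i (Some b) X).
  by rewrite svshift_set.
by rewrite ffunE cbasis_shift svsign_shift [RHS]ffunE.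
Qed.

End JoinComplex.

(** * The Tucker lemma *)

Section Tucker.
Variables (I : finType) (G : finZmodType).
Local Notation signvec := (signvec I G).
Local Notation sv0 := (sv0 I G).
Implicit Types (X Y Z : signvec) (i : I) (a b : G).
Variables (level : signvec -> I) (label : signvec -> G).
Hypothesis card_G_gt1 : (1 < #|G|)%N.
Hypothesis level_shift : forall a X, X != sv0 -> level (svshift a X) = level X.
Hypothesis label_shift : forall a X, X != sv0 -> label (svshift a X) = label X + a.
Hypothesis label_level :
  forall X Y, X != sv0 -> svle X Y -> level X = level Y -> label X = label Y.

Local Notation R := 'Z_#|G|.
Local Notation chain := {ffun signvec -> R^o}.
Local Notation boundary := (@boundary R I G).

(* [push X] is the image under the labelling of the barycentric subdivision of the face [X],
   which is the cone from the barycentre of [X] over the subdivision of its boundary. *)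
Fixpoint push_rec n X : chain :=
  if n is m.+1 then linext (svjoin R (level X) (label X)) (linext (push_rec m) (boundary X))
  else cbasis R X.

Definition push X := push_rec #|svsupp X| X.

Lemma push0 : push sv0 = cbasis R sv0.
Proof. by rewrite /push svsupp0 cards0. Qed.

Lemma pushE X : X != sv0 ->
  push X = linext (svjoin R (level X) (label X)) (linext push (boundary X)).
Proof.
rewrite -svsupp_eq0 => /set0Pn[i iX]; rewrite {1}/push (card_svsupp_erase iX) /=.
congr (linext _ _); apply: eq_linext => Y /boundary_neq0[k kX ->]; rewrite /push.
by congr push_rec; apply: succn_inj; rewrite -!card_svsupp_erase.
Qed.

Lemma push_rec_shift n a X Y :
  push_rec n (svshift a X) (svshift a Y) = push_rec n X Y.
Proof.
elim: n X Y => [|n IH] X Y /=; first exact: cbasis_shift.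
have [->|nX] := eqVneq X sv0; first by rewrite svshift_sv0 boundary_sv0 !linear0 !ffunE.
rewrite level_shift // label_shift //; apply: linext_shift => [Z W|Z].
  exact: svjoin_shift.
by apply: linext_shift IH _ _ => W; apply: boundary_shift.
Qed.

Lemma push_shift a X Y : push (svshift a X) (svshift a Y) = push X Y.
Proof. by rewrite /push svsupp_shift push_rec_shift. Qed.

Lemma push_vertices X Y i a : push X Y != 0 -> Y i = Some a ->
  exists Z, [/\ Z != sv0, svle Z X, level Z = i & label Z = a].
Proof.
elim/face_ind: X Y i a => [Y i a|X nX IH Y i a].
  by rewrite push0 ffunE; have [<-|] := eqVneq sv0 Y; rewrite ?eqxx // ffunE.
rewrite pushE // => /linext_neq0[Y' /linext_neq0[X' /boundary_neq0[k kX ->] pY']].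
rewrite /svjoin; case: ifP => [_|]; last by rewrite ffunE eqxx.
rewrite !ffunE; have [<-|] := eqVneq _ Y; last by rewrite scaler0 eqxx.
rewrite ffunE => _; have [-> [<-]|_ Yi] := eqVneq i (level X).
  by exists X; rewrite svle_refl.
have [Z [nZ ZX lZ aZ]] := IH _ kX _ _ _ pY' Yi.
by exists Z; split=> //; apply: svle_trans ZX (svle_erase _ _).
Qed.

Lemma push_join_compatible X Y : X != sv0 -> linext push (boundary X) Y != 0 ->
  Y (level X) \in [:: None; Some (label X)].
Proof.
move=> nX /linext_neq0[X' /boundary_neq0[k kX ->] pY]; rewrite !inE.
case Ya: (Y (level X)) => [a|] //=; have [Z [nZ ZX lZ <-]] := push_vertices pY Ya.
by rewrite (label_level nZ (svle_trans ZX (svle_erase _ _)) lZ).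
Qed.

Lemma boundary_push X : linext boundary (push X) = linext push (boundary X).
Proof.
elim/face_ind: X => [|X nX IH].
  by rewrite push0 linext_basis boundary_sv0 linear0.
have boundary_face : linext boundary (linext push (boundary X)) = 0.
  rewrite linext_comp -[RHS](linear0 (linext push)) -(boundary_boundary R X).
  rewrite [RHS]linext_comp.
  by apply: eq_linext => Y /boundary_neq0[k kX ->]; apply: IH.
have := boundary_join (fun Y => @push_join_compatible X Y nX).
by rewrite -pushE // boundary_face linear0 addr0.
Qed.

Lemma push_supertrace_missed i : (forall X, X != sv0 -> level X != i) ->
  \sum_X (-1) ^+ #|svsupp X| * push X X = 0.
Proof.
move=> missed; pose g X := linext (svjoin R i 0) (push X).
have homotopy X : linext boundary (g X) + linext g (boundary X) = push X.
  rewrite -[RHS](@boundary_join _ _ _ i 0) => [|Y pY].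
    by rewrite boundary_push; congr (_ + _); rewrite linext_comp.
  rewrite !inE; case Yi: (Y i) => [a|] //; have [Z [nZ _ lZ _]] := push_vertices pY Yi.
  by have := missed Z nZ; rewrite lZ eqxx.
under eq_bigr do rewrite -homotopy.
apply: supertrace_homotopy => X Y /boundary_neq0[k kX ->].
by rewrite (card_svsupp_erase kX) exprS mulN1r opprK.
Qed.

Lemma push_supertrace : \sum_X (-1) ^+ #|svsupp X| * push X X = 1.
Proof.
rewrite (bigD1 sv0) //= push0 ffunE eqxx.
rewrite svsupp0 cards0 expr0 mulr1 -[RHS]addr0; congr (_ + _).
rewrite (partition_big label predT) //=.
pose fiber a := \sum_(X | (X != sv0) && (label X == a)) (-1) ^+ #|svsupp X| * push X X.
have fiber0 a : fiber a = fiber 0.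
  rewrite /fiber (reindex_inj (@svshift_inj _ _ a)); apply: eq_big => [X|X _].
    rewrite svshift_eq0; case: (eqVneq X sv0) => //= nX.
    by rewrite label_shift // -subr_eq0 addrK.
  by rewrite svsupp_shift push_shift.
rewrite (eq_bigr (fun=> fiber 0)) => [|a _]; last exact: fiber0.
by rewrite sumr_const -mulr_natr pchar_Zp // mulr0.
Qed.

Theorem tucker_surjective i : exists2 X, X != sv0 & level X = i.
Proof.
have /existsP[X /andP[nX /eqP lX]] : [exists X, (X != sv0) && (level X == i)].
  apply: contraTT isT => /existsPn missed.
  have := push_supertrace; rewrite (@push_supertrace_missed i) => [/eqP|X nX].
    by rewrite eq_sym oner_eq0.
  by have := missed X; rewrite nX.
by exists X.
Qed.

End Tucker.

Corollary tucker (I : finType) (G : finZmodType) (m : nat)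
    (level : signvec I G -> nat) (label : signvec I G -> G) :
    (1 < #|G|)%N ->
    (forall X, X != sv0 I G -> (0 < level X <= m)%N) ->
    (forall a X, X != sv0 I G -> level (svshift a X) = level X) ->
    (forall a X, X != sv0 I G -> label (svshift a X) = label X + a) ->
    (forall X Y, X != sv0 I G -> svle X Y -> level X = level Y -> label X = label Y) ->
  (#|I| <= m)%N.
Proof.
move=> G1 level_bound level_shift label_shift label_level.
rewrite leqNgt; apply/negP => mI.
have /card_gt0P[i0 _] : (0 < #|I|)%N by apply: leq_ltn_trans mI.
pose coord k := nth i0 (enum I) k.
have coord_inj : {in [pred k | (k <= m)%N] &, injective coord}.
  move=> k l km lm /eqP; rewrite nth_uniq -?cardE ?enum_uniq ?(leq_ltn_trans _ mI) //.
  by move/eqP.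
have level_le X : X != sv0 I G -> level X \in [pred k | (k <= m)%N].
  by case/level_bound/andP.
have [|X Y nX XY /=|X nX] :=
  @tucker_surjective _ _ (coord \o level) label G1 _ label_shift _ (coord 0).
- by move=> a X nX /=; rewrite level_shift.
- move/coord_inj => eXY; apply: label_level => //; apply: eXY; apply: level_le => //.
  exact: svle_neq0 XY.
move/coord_inj => level0; have := level_bound X nX.
by rewrite level0 //; apply: level_le.
Qed.

(** * Equivariant labels *)

Section OrbitLabel.
Variables (G : finZmodType) (T : choiceType) (act : G -> T -> T).
Hypothesis act0 : forall x, act 0 x = x.
Hypothesis actD : forall a b x, act a (act b x) = act (a + b) x.

Definition orbit_pred x := [pred y | [exists a, act a x == y]].
Definition orbit_rep x := choose (orbit_pred x) x.
Definition orbit_label x : G := odflt 0 [pick a | act a (orbit_rep x) == x].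

Lemma orbit_pred_refl x : orbit_pred x x.
Proof. by apply/existsP; exists 0; rewrite act0. Qed.

Lemma orbit_rep_act a x : orbit_rep (act a x) = orbit_rep x.
Proof.
have orbit_act : orbit_pred (act a x) =1 orbit_pred x.
  move=> y; apply/existsP/existsP => -[b /eqP <-]; first by exists (b + a); rewrite actD.
  by exists (b - a); rewrite actD subrK.
rewrite /orbit_rep (eq_choose orbit_act); apply: choose_id; last exact: orbit_pred_refl.
by rewrite -orbit_act; apply: orbit_pred_refl.
Qed.

Lemma orbit_labelK x : act (orbit_label x) (orbit_rep x) = x.
Proof.
rewrite /orbit_label; case: pickP => [a /eqP //|no_label].
have /existsP[a /eqP ax] := chooseP (orbit_pred_refl x).
by have := no_label (- a); rewrite /orbit_rep -ax actD addNr act0 eqxx.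
Qed.

Hypothesis prime_G : prime #|G|.

Lemma prime_act_fixed b x : b != 0 -> act b x = x -> forall a, act a x = x.
Proof.
move=> b0 bx a; have bG : b \in ([set: G]^#)%g by rewrite !inE b0.
have : a \in [set: G] by rewrite inE.
rewrite (nt_gen_prime _ bG) ?cardsT // => /cycleP[n ->]; rewrite FinRing.zmodXgE.
by elim: n => [|n IH]; rewrite ?mulr0n ?act0 // mulrSr -actD bx.
Qed.

Lemma orbit_label_act a x : (exists b, act b x != x) ->
  orbit_label (act a x) = orbit_label x + a.
Proof.
move=> [b bx]; have := orbit_labelK (act a x); have := orbit_labelK x.
rewrite orbit_rep_act; set r := orbit_rep x; set k := orbit_label (act a x).
set l := orbit_label x => lr kr.
have fixed : act (k - (l + a)) (act a x) = act a x.
  by rewrite -[RHS]kr -{1}lr !actD -addrA [a + l]addrC subrK.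
apply/eqP; rewrite -subr_eq0; apply: contraNT bx => nz; apply/eqP.
have orbit_ax c : act c x = act a x.
  by rewrite -(prime_act_fixed nz fixed (c - a)) actD subrK.
by rewrite orbit_ax -(orbit_ax 0) act0.
Qed.

End OrbitLabel.

Section Rotation.
Variables (G : finZmodType) (T : Type).
Implicit Types (A : {ffun G -> T}) (a b t : G).

Definition rotate a A : {ffun G -> T} := [ffun t => A (t - a)].

Lemma rotate0 A : rotate 0 A = A.
Proof. by apply/ffunP => t; rewrite ffunE subr0. Qed.

Lemma rotateD a b A : rotate a (rotate b A) = rotate (a + b) A.
Proof. by apply/ffunP => t; rewrite !ffunE opprD addrA. Qed.

End Rotation.

Section Families.
Variables (G : finZmodType) (F : finType).
Implicit Types (A B : {ffun G -> {set F}}) (a t : G).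

Definition family_size A := (\sum_t #|A t|)%N.

Definition no_common_element A := forall x, exists t, x \notin A t.

Lemma family_size_gt0P A : reflect (exists t, A t != set0) (0 < family_size A)%N.
Proof.
rewrite lt0n sum_nat_eq0; apply: (iffP forallPn) => -[t At]; exists t.
  by move: At; rewrite cards_eq0.
by rewrite cards_eq0.
Qed.

Lemma family_size_rotate a A : family_size (rotate a A) = family_size A.
Proof.
rewrite /family_size [RHS](reindex_inj (addIr (- a))).
by apply: eq_bigr => t _; rewrite ffunE.
Qed.

Lemma family_size_leqif A B : (forall t, A t \subset B t) ->
  (family_size A <= family_size B ?= iff (A == B))%N.
Proof.
move=> AB; have AtBt t : true -> (#|A t| <= #|B t| ?= iff (A t == B t))%N.
  by move=> _; apply: subset_leqif_cards.
have [le_size eq_size] := leqif_sum AtBt; split=> //; rewrite [LHS]eq_size.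
apply/forallP/eqP => [ABt|-> t]; last exact: eqxx.
by apply/ffunP => t; apply/eqP/ABt.
Qed.

Lemma family_size_le A : no_common_element A -> (family_size A <= #|F| * #|G|.-1)%N.
Proof.
move=> noA; have -> : family_size A = (\sum_x #|[set t | x \in A t]|)%N.
  rewrite /family_size; under eq_bigr do rewrite -sum1_card big_mkcond.
  rewrite exchange_big; apply: eq_bigr => x _; rewrite -big_mkcond -sum1_card.
  by apply: eq_bigl => t; rewrite inE.
rewrite -sum_nat_const; apply: leq_sum => x _; have [t xt] := noA x.
have G0 : (0 < #|G|)%N by apply/card_gt0P; exists t.
rewrite -ltnS prednK // -cardsT; apply/proper_card/properP.
by split; [apply: subsetT | exists t; rewrite ?inE].
Qed.

Lemma no_common_element_rotate A : no_common_element A -> (0 < family_size A)%N ->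
  exists a, rotate a A != A.
Proof.
move=> noA /family_size_gt0P[t /set0Pn[x xt]]; have [u xu] := noA x.
exists (u - t); apply: contraNneq xu => /ffunP/(_ u).
by rewrite ffunE opprB addrC subrK => <-.
Qed.

Definition family_label := @orbit_label G {ffun G -> {set F}} (@rotate G {set F}).

Lemma family_label_rotate a A :
    prime #|G| -> no_common_element A -> (0 < family_size A)%N ->
  family_label (rotate a A) = family_label A + a.
Proof.
move=> G_prime noA A0; apply: orbit_label_act => //; first exact: rotate0.
  exact: rotateD.
exact: no_common_element_rotate.
Qed.

End Families.

(** * Covers by sets of one colour *)

Local Notation ksubset V d := {S : {set V} | #|S| == d}.

Section Colouring.
Variables (V C : finType) (G : finZmodType) (d : nat) (f : ksubset V d -> C).
Local Notation dset := (ksubset V d).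
(* A point carries fewer signs than [#|G|], having only [#|G|.-1] copies. *)
Local Notation copies := (V * 'I_#|G|.-1)%type.
Local Notation signvec := (signvec copies G).
Local Notation sv0 := (sv0 copies G).
Implicit Types (X Y : signvec) (t a : G).

Definition parts X : {ffun G -> {set V}} :=
  [ffun t => [set x | [exists r, X (x, r) == Some t]]].

Lemma partsP X t x : reflect (exists r, X (x, r) = Some t) (x \in parts X t).
Proof.
rewrite ffunE inE; apply: (iffP existsP) => -[r Xr]; exists r; exact/eqP.
Qed.

Lemma parts_subset X Y t : svle X Y -> parts X t \subset parts Y t.
Proof.
move/svleP => XY; apply/subsetP => x /partsP[r Xr]; apply/partsP; exists r.
by case: (XY (x, r)); rewrite Xr.
Qed.

Lemma parts_shift a X : parts (svshift a X) = rotate a (parts X).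
Proof.
apply/ffunP => t; rewrite [RHS]ffunE; apply/setP => x.
apply/partsP/partsP => -[r]; rewrite ?ffunE => Xr; exists r.
  by case: (X (x, r)) Xr => //= u [<-]; rewrite addrK.
by rewrite ffunE Xr /= subrK.
Qed.

Lemma no_common_element_parts X : no_common_element (parts X).
Proof.
move=> x; apply/existsP; rewrite -negb_forall; apply/negP => /forallP all_t.
have copy t : {r | X (x, r) == Some t}.
  by apply: sigW; have /partsP[r /eqP] := all_t t; exists r.
have copy_inj : injective (fun t => sval (copy t)).
  move=> t u /= tu; have := svalP (copy t); rewrite tu (eqP (svalP (copy u))).
  by move=> /eqP[].
have := leq_card _ copy_inj; rewrite card_ord leqNgt prednK ?leqnn //.
by apply/card_gt0P; exists 0.
Qed.

Lemma parts_size_gt0 X : X != sv0 -> (0 < family_size (parts X))%N.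
Proof.
rewrite -svsupp_eq0 => /set0Pn[[x r]]; rewrite inE.
case Xr: (X (x, r)) => [t|] // _; apply/family_size_gt0P; exists t.
by apply/set0Pn; exists x; apply/partsP; exists r.
Qed.

Definition colours X : {ffun G -> {set C}} :=
  [ffun t => [set f A | A : dset & ~: val A \subset parts X t]].

Lemma coloursP X t k :
  reflect (exists2 A : dset, ~: val A \subset parts X t & f A = k) (k \in colours X t).
Proof.
rewrite [colours X t]ffunE; apply: (iffP imsetP) => -[A]; rewrite ?inE => AX fA.
  by exists A.
by exists A; rewrite ?inE.
Qed.

Lemma colours_subset X Y t : svle X Y -> colours X t \subset colours Y t.
Proof.
move=> XY; apply/subsetP => k /coloursP[A AX fA]; apply/coloursP.
by exists A => //; apply: subset_trans AX (parts_subset t XY).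
Qed.

Lemma colours_shift a X : colours (svshift a X) = rotate a (colours X).
Proof. by apply/ffunP => t; rewrite [RHS]ffunE ![colours _ _]ffunE parts_shift ffunE. Qed.

Hypothesis d_le_V : (d <= #|V|)%N.

Lemma card_parts_lt X t : colours X t = set0 -> (#|parts X t| < #|V| - d)%N.
Proof.
move=> no_colour; rewrite ltnNge; apply/negP; rewrite -bin_gt0 -cards_draws.
case/card_gt0P => B; rewrite inE => /andP[BX /eqP cardB].
have cardCB : #|~: B| == d by rewrite cardsCs setCK cardB subKn.
suff : f (Sub (~: B) cardCB) \in colours X t by rewrite no_colour inE.
by apply/coloursP; exists (Sub (~: B) cardCB); rewrite // SubK setCK.
Qed.

Hypothesis G_prime : prime #|G|.
Hypothesis no_mono_cover : forall (S : G -> dset) k,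
  (forall t, f (S t) = k) -> \bigcup_t val (S t) != [set: V].

Lemma no_common_element_colours X : no_common_element (colours X).
Proof.
move=> k; apply/existsP; rewrite -negb_forall; apply/negP => /forallP all_t.
have pick_set t : {A : dset | (~: val A \subset parts X t) && (f A == k)}.
  by apply: sigW; have /coloursP[A AX /eqP fA] := all_t t; exists A; rewrite AX.
have pick_mono t : f (sval (pick_set t)) = k by have /andP[_ /eqP] := svalP (pick_set t).
case/eqP: (no_mono_cover pick_mono); apply/setP => x; rewrite inE.
have [t] := no_common_element_parts X x; have /andP[AX _] := svalP (pick_set t).
by move=> /(contra (subsetP AX x)); rewrite inE negbK => xA; apply/bigcupP; exists t.
Qed.

(* [high X] means that some part contains the complement of a [d]-set. *)
Definition high X := (0 < family_size (colours X))%N.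

Definition level X : nat :=
  (if high X then #|G| * (#|V| - d).-1 + family_size (colours X)
   else family_size (parts X))%N.

Definition label X : G :=
  if high X then family_label (colours X) else family_label (parts X).

Lemma high_shift a X : high (svshift a X) = high X.
Proof. by rewrite /high colours_shift family_size_rotate. Qed.

Lemma high_mono X Y : svle X Y -> high X -> high Y.
Proof.
move=> XY hX; apply: leq_trans hX _.
by rewrite (family_size_leqif (fun t => colours_subset t XY)).
Qed.

Lemma parts_size_low X : ~~ high X -> (family_size (parts X) <= #|G| * (#|V| - d).-1)%N.
Proof.
rewrite -leqNgt leqn0 sum_nat_eq0 => /forallP no_colour.
rewrite -sum_nat_const; apply: leq_sum => t _.
have no_colour_t : colours X t = set0 by apply/eqP; rewrite -cards_eq0; apply: no_colour.
by rewrite -ltnS (leq_trans (card_parts_lt no_colour_t)) ?leqSpred.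
Qed.

Lemma level_shift a X : level (svshift a X) = level X.
Proof. by rewrite /level high_shift colours_shift parts_shift !family_size_rotate. Qed.

Lemma label_shift a X : X != sv0 -> label (svshift a X) = label X + a.
Proof.
move=> nX; rewrite /label high_shift colours_shift parts_shift.
case: ifP => hX; apply: family_label_rotate => //.
- exact: no_common_element_colours.
- exact: no_common_element_parts.
exact: parts_size_gt0.
Qed.

Lemma label_level X Y : svle X Y -> level X = level Y -> label X = label Y.
Proof.
move=> XY; have [_ sizeP] := family_size_leqif (fun t => parts_subset t XY).
have [_ sizeC] := family_size_leqif (fun t => colours_subset t XY).
rewrite /level /label; have := high_mono XY.
case: ifP => [_ ->// /addnI/eqP|/negbT lX _]; first by rewrite sizeC => /eqP->.
case: ifP => [hY e|_ /eqP]; last by rewrite sizeP => /eqP->.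
have := parts_size_low lX.
by rewrite e leqNgt -[X in (X < _)%N]addn0 ltn_add2l -/(high Y) hY.
Qed.

Lemma level_bound X : X != sv0 ->
  (0 < level X <= #|G| * (#|V| - d).-1 + #|C| * #|G|.-1)%N.
Proof.
move=> nX; rewrite /level; case: ifP => [hX|/negbT/parts_size_low lX].
  rewrite leq_add2l family_size_le ?andbT; last exact: no_common_element_colours.
  by rewrite (leq_trans hX) ?leq_addl.
by rewrite parts_size_gt0 // (leq_trans lX) ?leq_addr.
Qed.

Lemma no_mono_cover_card :
  (#|V| * #|G|.-1 <= #|G| * (#|V| - d).-1 + #|C| * #|G|.-1)%N.
Proof.
have -> : (#|V| * #|G|.-1 = #|{: copies}|)%N by rewrite card_prod card_ord.
apply: (tucker (prime_gt1 G_prime) level_bound _ label_shift) => [a X _|X Y _].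
  exact: level_shift.
exact: label_level.
Qed.

End Colouring.

Theorem prime_mono_cover (V C : finType) (G : finZmodType) (d : nat) (f : ksubset V d -> C) :
    prime #|G| -> (#|C| <= d <= #|V|)%N ->
    (#|V| - #|C| + 1 <= #|G| * (d - #|C| + 1))%N ->
  exists S : G -> ksubset V d,
    \bigcup_t val (S t) = [set: V] /\ exists k, forall t, f (S t) = k.
Proof.
move=> G_prime /andP[Cd]; rewrite leq_eqVlt => /predU1P[d_eq _|dV VG].
  have cardV : #|[set: V]| == d by rewrite cardsT d_eq.
  exists (fun=> Sub setT cardV); split; last by exists (f (Sub setT cardV)).
  by rewrite SubK; apply/setP => x; rewrite !inE; apply/bigcupP; exists 0; rewrite ?inE.
pose covers (S : G -> ksubset V d) k :=
  (\bigcup_t val (S t) == [set: V]) && [forall t, f (S t) == k].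
have [/existsP[S /existsP[k /andP[/eqP cover_S /forallP fS]]]|no_cover] :=
    boolP [exists S : {ffun G -> ksubset V d}, exists k, covers S k].
  by exists S; split=> //; exists k => t; apply/eqP.
have : (#|V| * #|G|.-1 <= #|G| * (#|V| - d).-1 + #|C| * #|G|.-1)%N.
  apply: (@no_mono_cover_card _ _ _ _ f) => // [|S k fS]; first exact: ltnW.
  apply: contra no_cover => /eqP cover_S; apply/existsP; exists (finfun S).
  apply/existsP; exists k; rewrite /covers; under eq_bigr do rewrite ffunE.
  by rewrite cover_S eqxx; apply/forallP => t; rewrite ffunE fS.
by have := prime_gt1 G_prime; nia.
Qed.

Local Close Scope ring_scope.

Lemma leq_ceil_div a b p : 0 < b -> ceil_div a b <= p -> a <= p * b.
Proof.
by move=> b0; rewrite /ceil_div -ltnS ltn_divLR // mulSn; lia.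
Qed.

Theorem theorem2p6 (q d c p : nat) :
  1 <= c -> c <= d -> d <= q ->
  is_least_prime_geq p (ceil_div (q - c + 1) (d - c + 1)) ->
  forall f : dsubset q d -> 'I_c, has_cover q d c p f.
Proof.
move=> _ cd dq [p_prime [le_p _]] f.
case: p p_prime le_p => [|[|m]] // p_prime /leq_ceil_div le_p.
apply: (@prime_mono_cover _ _ 'I_m.+2 d f); rewrite ?card_ord ?cd //.
by apply: le_p; rewrite addn1.
Qed.
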